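(* Let $(\Omega,\mathcal F)$ be a measurable space, $\tau:\Omega\to\Omega$ an $\mathcal F/\mathcal F$-measurable transformation, and $\nu:\mathcal F\to[0,1]$ a lower probability. If $\nu$ is invariant (i.e. $\nu(A)=\nu(\tau^{-1}(A))$ for all $A\in\mathcal F$), then for each $f\in B(\Omega,\mathcal F)$ there exists $f^\star\in B(\Omega,\mathcal G)$ such that $$\lim_{n}\frac1n\sum_{k=1}^n f(\tau^{k-1}(\omega))=f^\star(\omega)\qquad \nu\text{-a.s.}$$ Moreover, if $\nu$ is ergodic (i.e. $\nu(\mathcal G)=\{0,1\}$), then $$\nu\left(\left\{\omega\in\Omega:\int_\Omega f^\star\,d\nu\le\lim_n\frac1n\sum_{k=1}^n f(\tau^{k-1}(\omega))\le\int_\Omega f^\star\,d\bar\nu\right\}\right)=1 .$$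
   Context: A probability measure means a countably additive probability; $\Delta^\sigma(\Omega,\mathcal F)$ is the set of all probability measures on $\mathcal F$, with the topology of setwise convergence of nets ($P_\alpha\to P$ iff $P_\alpha(A)\to P(A)$ for all $A\in\mathcal F$). A set function $\nu:\mathcal F\to[0,1]$ is a lower probability if there is a compact set $\mathcal M\subseteq\Delta^\sigma(\Omega,\mathcal F)$ with $\nu(A)=\min_{P\in\mathcal M}P(A)$ for all $A\in\mathcal F$. Its conjugate is $\bar\nu(A)=1-\nu(A^c)$. $\mathcal G=\{A\in\mathcal F:\tau^{-1}(A)=A\}$ is the $\sigma$-algebra of invariant events. For a $\sigma$-algebra $\mathcal H$, $B(\Omega,\mathcal H)$ is the set of bounded $\mathcal H$-measurable functions $\Omega\to\mathbb R$. For a monotone set function $\nu$ with $\nu(\emptyset)=0$, $\nu(\Omega)=1$, and $f\in B(\Omega,\mathcal F)$, the Choquet integral is $\int_\Omega f\,d\nu=\int_0^\infty\nu(\{f\ge t\})\,dt+\int_{-\infty}^0[\nu(\{f\ge t\})-\nu(\Omega)]\,dt$. A statement holds $\nu$-a.s. if there is $A\in\mathcal F$ with $\nu(A)=1$ such that it holds for all $\omega\in A$. In sets whose description involves a limit, membership of $\omega$ includes existence of the limit at $\omega$. $\nu(\mathcal G)$ denotes $\{\nu(A):A\in\mathcal G\}$. *)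

(* Defs.v *)
From HB Require Import structures.
From mathcomp Require Import all_boot all_order all_algebra.
From mathcomp Require Import all_classical all_reals all_analysis.

Set Implicit Arguments.
Unset Strict Implicit.
Unset Printing Implicit Defensive.

Import Order.TTheory GRing.Theory Num.Theory.
Import numFieldNormedType.Exports.

Local Open Scope classical_set_scope.
Local Open Scope ring_scope.

(* Set functions on the sigma-algebra of T are total functions [set T -> R];
   only their values on measurable sets are meaningful. *)

(* Setwise convergence: the initial topology for the evaluations P |-> P(A),
   A ranging over the measurable sets only. A measure of the library is a
   function on all sets, so two measures agreeing on the measurable sets may be
   distinct points; they are topologically indistinguishable here, hence
   compactness is not affected. *)
Definition setwise_eval d (T : measurableType d) (R : realType)
    (P : probability T R) : {ptws {A : set T | measurable A} -> R} :=
  fun A => fine (P (sval A)).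

Definition setwise_probability d (T : measurableType d) (R : realType) :
    topologicalType :=
  initial_topology (@setwise_eval d T R).

Lemma cvg_setwiseP d (T : measurableType d) (R : realType)
    (F : set_system (probability T R)) (P : probability T R) : Filter F ->
  (F --> (P : setwise_probability T R)) <->
  (forall A, measurable A -> fine (Q A) @[Q --> F] --> fine (P A)).
Proof.
move=> FF; split=> [FP A mA|FP].
- have cev : continuous (fun Q : setwise_probability T R => setwise_eval Q) :=
    @initial_continuous _ _ (@setwise_eval d T R).
  have cpr : continuous (fun h : {ptws {A : set T | measurable A} -> R} =>
      h (exist _ A mA)).
    move=> h V; rewrite nbhsE => -[W [oW Wh] WV].
    have /cvg_sup/(_ (exist _ A mA)) : h --> h by exact: cvg_id.
    apply.
    exists ((fun g : {A : set T | measurable A} -> R =>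
      g (exist _ A mA)) @^-1` W); split=> //; last by move=> g; exact: WV.
    by exists W.
  exact: (cvg_trans (cvg_app _ FP) (continuous_comp (cev P) (cpr _))).
- have cF : @setwise_eval d T R @ F --> @setwise_eval d T R P.
    apply/cvg_sup => -[A mA] V [_ [[W oW <-] WPA WV]].
    apply: (@filterS _ F FF (fun Q => W (fine (Q A)))) => [Q WQ|].
      exact: WV.
    by apply: FP => //; exact: open_nbhs_nbhs.
  move=> V [_ [[W oW <-] WP WV]].
  apply: (@filterS _ F FF (fun Q => W (setwise_eval Q))) => [Q WQ|].
    exact: WV.
  by apply: cF; exact: open_nbhs_nbhs.
Qed.

Definition lower_probability d (T : measurableType d) (R : realType)
    (nu : set T -> R) : Prop :=
  exists M : set (setwise_probability T R), compact M /\
    forall A : set T, measurable A ->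
      (exists2 P : probability T R, M P & P A = (nu A)%:E) /\
      (forall P : probability T R, M P -> ((nu A)%:E <= P A)%E).

Definition conjugate (T : Type) (R : realType) (nu : set T -> R) : set T -> R :=
  fun A => 1 - nu (~` A).

Definition invariant_events d (T : measurableType d) (tau : T -> T) :
    set (set T) :=
  [set A | measurable A /\ tau @^-1` A = A].

Lemma invariant_events_sigma_algebra d (T : measurableType d) (tau : T -> T) :
  measurable_fun [set: T] tau -> sigma_algebra setT (invariant_events tau).
Proof.
move=> mtau; split=> [|A [mA iA]|A iA].
- by split; [exact: measurable0|exact: preimage_set0].
- rewrite setTD; split; first exact: measurableC.
  by rewrite -preimage_setC iA.
- split; first by apply: bigcup_measurable => n _; case: (iA n).
  by rewrite preimage_bigcup; apply: eq_bigcupr => n _; case: (iA n).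
Qed.

(* On [g_sigma_algebraType (invariant_events tau)] this is the set of bounded
   functions measurable for the sigma-algebra of invariant events. *)
Definition bounded_measurable d (T : measurableType d) (R : realType) :
    set (T -> R) :=
  [set f : T -> R | bounded_fun f /\ measurable_fun [set: T] f].

Lemma measurable_invariantE d (T : measurableType d) (tau : T -> T) :
  measurable_fun [set: T] tau ->
  (measurable : set (set (g_sigma_algebraType (invariant_events tau)))) =
  invariant_events tau.
Proof.
by move=> mtau; rewrite measurable_g_measurableTypeE//;
  exact: invariant_events_sigma_algebra.
Qed.

Definition invariant_set_function d (T : measurableType d) (R : realType)
    (tau : T -> T) (nu : set T -> R) : Prop :=
  forall A : set T, measurable A -> nu A = nu (tau @^-1` A).

Definition ergodic d (T : measurableType d) (R : realType)
    (tau : T -> T) (nu : set T -> R) : Prop :=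
  nu @` invariant_events tau = [set 0; 1].

Definition choquet (T : Type) (R : realType) (nu : set T -> R) (f : T -> R) : R :=
  (\int[lebesgue_measure]_(t in `[0, +oo[) nu [set w | t <= f w]) +
  (\int[lebesgue_measure]_(t in `]-oo, 0]) (nu [set w | t <= f w] - nu setT)).

Definition almost_surely d (T : measurableType d) (R : realType)
    (nu : set T -> R) (Q : T -> Prop) : Prop :=
  exists A : set T, [/\ measurable A, nu A = 1 & forall w, A w -> Q w].

Definition time_average (T : Type) (R : realType) (tau : T -> T) (f : T -> R)
    (w : T) : R^nat :=
  fun n => n%:R^-1 * \sum_(1 <= k < n.+1) f (iter k.-1 tau w).

(* Main.v *)
(* Members of the core of [nu] need not be invariant, so Birkhoff's theorem does
   not apply to them directly. But invariance of [nu] gives [P (tau^-k B) >= nu B] for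
   all [k] and all [P] in the core, and by compactness [nu (B N) --> 1] whenever
   [B N] increases to the whole space; so [P (tau^-k B N) --> 1] uniformly in
   [k]. This is all that the maximal ergodic argument needs. With [u] the limsup
   of the time averages of [f], the function [g = f - u + e] has a positive
   orbit sum from every point; if [F N] is the maximum of [0] and the first [N]
   orbit sums of [g], then [F N - F N \o tau <= g] off the set [F N = 0], whose
   preimages under iterates of [tau] are uniformly small. Telescoping along
   orbits for both [f] and [- f] bounds the probability that limsup and liminf
   differ by [e].
   In the ergodic case [nu] is [0] or [1] on superlevel sets of the invariant
   limit [fstar], so both Choquet integrals are thresholds of 0-1 step functions,
   i.e. the essential infimum and supremum of [fstar]. *)
Require Import Defs.
From HB Require Import structures.
From mathcomp Require Import all_boot all_order all_algebra.
From mathcomp Require Import all_classical all_reals all_analysis.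
From mathcomp Require Import measurable_realfun ring lra.

Set Implicit Arguments.
Unset Strict Implicit.
Unset Printing Implicit Defensive.

Import Order.TTheory GRing.Theory Num.Theory.
Import numFieldNormedType.Exports.

Local Open Scope classical_set_scope.
Local Open Scope ring_scope.

(** * Lower probabilities and their cores *)

Section lower_probability.
Context d (T : measurableType d) (R : realType) (nu : set T -> R).

(** The core in the sense of cooperative games, restricted to countably additive members; it
    contains the compact set representing [nu]. *)
Definition core : set (probability T R) :=
  [set P | forall A, measurable A -> ((nu A)%:E <= P A)%E].

Hypothesis nu_lower : lower_probability nu.

Lemma lower_probability_attained A : measurable A ->
  exists2 P : probability T R, core P & P A = (nu A)%:E.
Proof.
move=> mA; have [M [_ Mnu]] := nu_lower.
have [[P MP PA] _] := Mnu A mA.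
by exists P => // B mB; apply: (Mnu B mB).2.
Qed.

(** [nu A] is a minimum attained in the core. This reduces almost sure statements to one countably
    additive probability at a time. *)
Lemma lower_probability_eq1 A : measurable A ->
  nu A = 1 <-> forall P : probability T R, core P -> P A = 1%E.
Proof.
move=> mA; split=> [nuA P cP|PA1].
  apply/eqP; rewrite eq_le probability_le1//=.
  by rewrite (le_trans _ (cP A mA))// nuA.
by have [P /PA1-> [<-]] := lower_probability_attained mA.
Qed.

Lemma lower_probability_le A B : measurable A -> measurable B ->
  A `<=` B -> nu A <= nu B.
Proof.
move=> mA mB AB; have [P cP PB] := lower_probability_attained mB.
by rewrite -lee_fin -PB (le_trans (cP A mA))// le_measure// inE.
Qed.

Lemma lower_probability_sub1 A B : measurable A -> measurable B ->
  A `<=` B -> nu A = 1 -> nu B = 1.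
Proof.
move=> mA mB AB nuA; apply/eqP; rewrite eq_le -{2}nuA lower_probability_le//.
have [P _ PB] := lower_probability_attained mB.
by rewrite -lee_fin -PB probability_le1.
Qed.

Lemma lower_probability0 : nu set0 = 0.
Proof.
by have [P _] := lower_probability_attained measurable0; rewrite measure0 => -[].
Qed.

Lemma lower_probabilityT : nu setT = 1.
Proof.
by apply/lower_probability_eq1 => // P _; rewrite probability_setT.
Qed.

Lemma lower_probability_bigcap1 (A : (set T)^nat) :
  (forall n, measurable (A n)) -> (forall n, nu (A n) = 1) ->
  nu (\bigcap_n A n) = 1.
Proof.
move=> mA nuA; have mI : measurable (\bigcap_n A n) by exact: bigcapT_measurable.
apply/lower_probability_eq1 => // P cP.
rewrite -[\bigcap_n _]setCK (probability_setC P (measurableC mI)).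
rewrite (_ : P (~` _) = 0%E) ?sube0//.
apply/negligibleP; first exact: measurableC.
rewrite setC_bigcap; apply: negligible_bigcup => n.
apply/negligibleP; first exact: measurableC.
apply: etrans (probability_setC P (mA n)) _.
by have -> := (lower_probability_eq1 (mA n)).1 (nuA n) P cP; rewrite subee.
Qed.

Lemma lower_probability_setI1 A B : measurable A -> measurable B ->
  nu A = 1 -> nu B = 1 -> nu (A `&` B) = 1.
Proof.
move=> mA mB nuA nuB; rewrite -bigcap2E.
by apply: lower_probability_bigcap1 => -[|[|n]] //=; exact: lower_probabilityT.
Qed.

(* Dini's argument: on the compact set of probabilities defining [nu], the
   convergence [P (B N) --> 1] is uniform in [P]. *)
Lemma lower_probability_continuousT (B : (set T)^nat) (e : R) :
  (forall N, measurable (B N)) -> nondecreasing_seq B ->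
  \bigcup_N B N = setT -> 0 < e -> exists N, 1 - e < nu (B N).
Proof.
move=> mB ndB BT e0; apply: contrapT => /forallNP nuB.
have [M [cM Mnu]] := nu_lower.
have /choice[Q QP] : forall N, exists P : probability T R,
    M P /\ P (B N) = (nu (B N))%:E.
  by move=> N; have [[P MP PE] _] := Mnu _ (mB N); exists P.
(* The minimizers [Q n] for the sets [B n] have a cluster point [P] in the compact set [M]. *)
have [] := cM (Q @ \oo); first by exists 0%N => // n _ /=; apply: (QP n).1.
move=> P [MP clP].
have PB N : fine (P (B N)) <= 1 - e.
  rewrite leNgt; apply/negP => ltP.
  have nP : nbhs (P : setwise_probability T R)
      [set P' | 1 - e < fine ((P' : probability T R) (B N))].
    have /cvg_setwiseP/(_ _ (mB N)) :
      nbhs (P : setwise_probability T R) --> (P : setwise_probability T R).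
      exact: cvg_id.
    by move=> /cvgr_gt; apply.
  (* Some [Q n] with [N <= n] is close to [P] on [B N], so [1 - e < Q n (B N) <= Q n (B n) = nu (B
     n)], a contradiction. *)
  have [|_ [[n /= Nn <-] /= ltQ]] := clP [set Q n | n in [set n | (N <= n)%N]]
    _ _ nP.
    by exists N => // n /= Nn; exists n.
  apply: (nuB n); rewrite (lt_le_trans ltQ)// -lee_fin -(QP n).2.
  rewrite fineK ?fin_num_measure// le_measure ?inE//.
  by apply/subsetPset/ndB.
have : P (B N) @[N --> \oo] --> 1%E.
  rewrite -(@probability_setT _ _ _ P) -BT.
  by apply: nondecreasing_cvg_mu => //; rewrite BT.
move=> /fine_cvgP[_] P1.
have : 1 <= 1 - e.
  rewrite -[leLHS](cvg_lim _ P1)//; apply: limr_le; last exact: nearW.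
  by apply/cvg_ex; exists 1.
lra.
Qed.

End lower_probability.

(** * Orbit sums and their running maximum *)

Section maximal_function.
Context (T : Type) (R : realType) (tau : T -> T) (g : T -> R).

Definition orbit_sum n w := \sum_(k < n) g (iter k tau w).

(** The maximum of the orbit sums of lengths 0 to [N], the empty sum contributing 0; the recursion
    peels off the first term [g w]. *)
Fixpoint max_orbit_sum N w : R :=
  if N is N'.+1 then Num.max 0 (g w + max_orbit_sum N' (tau w)) else 0.

Lemma orbit_sumS n w : orbit_sum n.+1 w = g w + orbit_sum n (tau w).
Proof.
rewrite /orbit_sum big_ord_recl; congr (_ + _).
by apply: eq_bigr => k _; rewrite -iterSr.
Qed.

Lemma max_orbit_sum_ge0 N w : 0 <= max_orbit_sum N w.
Proof. by case: N => //= N; rewrite le_max lexx. Qed.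

Lemma max_orbit_sum_ge n w : orbit_sum n w <= max_orbit_sum n w.
Proof.
elim: n w => [|n IH] w; first by rewrite /orbit_sum big_ord0.
by rewrite orbit_sumS /= le_max lerD2l IH orbT.
Qed.

Lemma nondecreasing_max_orbit_sum w :
  nondecreasing_seq (max_orbit_sum ^~ w).
Proof.
apply/nondecreasing_seqP => N.
elim: N w => [|N IH] w; first exact: max_orbit_sum_ge0.
rewrite -[leLHS]/(Num.max _ _) -[leRHS]/(Num.max _ _).
by apply: le_max2; rewrite ?lexx// lerD2l IH.
Qed.

Context (C : R) (gC : forall w, `|g w| <= C).

Lemma max_orbit_sum_le N w : max_orbit_sum N w <= N%:R * C.
Proof.
elim: N w => [|N IH] w /=; first by rewrite mul0r.
have := IH (tau w); have := gC w; rewrite ler_norml => /andP[_ gwC] FC.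
have C0 : 0 <= C by exact: le_trans (normr_ge0 _) (gC w).
rewrite ge_max mulr_ge0//= -natr1 mulrDl mul1r addrC lerD//.
Qed.

(* Where [max_orbit_sum N] is positive it is at most [g + max_orbit_sum N \o tau];
   elsewhere it vanishes and the cost is at most [C]. *)
Lemma max_orbit_sum_step N w :
  max_orbit_sum N w - max_orbit_sum N (tau w)
    - C * \1_[set w | max_orbit_sum N w <= 0] w <= g w.
Proof.
rewrite indicE; have [F0|F0] := lerP (max_orbit_sum N w) 0.
  rewrite mem_set//= mulr1.
  have := max_orbit_sum_ge0 N (tau w); have := gC w; rewrite ler_norml.
  lra.
rewrite memNset /=; last by apply/negP; rewrite -ltNge.
rewrite mulr0 subr0 lerBlDr.
case: N F0 => [|N]; first by rewrite ltxx.
move=> F0; have := nondecreasing_max_orbit_sum (tau w) (leqnSn N).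
move: F0; rewrite -[max_orbit_sum N.+1 w]/(Num.max _ _).
rewrite lt_max ltxx /= => x0; rewrite (max_idPr (ltW x0)).
by rewrite lerD2l.
Qed.

(** Summing [max_orbit_sum_step] along the orbit telescopes; the two boundary terms cost at most
    [N%:R * C], whatever [n] is. *)
Lemma orbit_sum_ge N n w :
  - (N%:R * C) - C * \sum_(k < n) \1_[set w | max_orbit_sum N w <= 0] (iter k tau w)
    <= orbit_sum n w.
Proof.
have tel : max_orbit_sum N w - max_orbit_sum N (iter n tau w)
    - C * \sum_(k < n) \1_[set w | max_orbit_sum N w <= 0] (iter k tau w)
    <= orbit_sum n w.
  elim: n => [|n IH]; first by rewrite /orbit_sum !big_ord0 /= subrr mulr0 subr0.
  rewrite /orbit_sum !big_ord_recr /= -/(orbit_sum n w).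
  have := max_orbit_sum_step N (iter n tau w).
  move: IH; lra.
apply: le_trans tel; rewrite lerD2r.
have := max_orbit_sum_ge0 N w; have := max_orbit_sum_le N (iter n tau w).
lra.
Qed.

End maximal_function.

Lemma measurable_iter d (T : measurableType d) (tau : T -> T) k :
  measurable_fun [set: T] tau -> measurable_fun [set: T] (iter k tau).
Proof.
move=> mtau; elim: k => [|k IH]; first exact: measurable_id.
rewrite (_ : iter k.+1 tau = tau \o iter k tau)//.
exact: measurableT_comp.
Qed.

Lemma measurable_max_orbit_sum d (T : measurableType d) (R : realType)
    (tau : T -> T) (g : T -> R) N :
  measurable_fun [set: T] tau -> measurable_fun [set: T] g ->
  measurable_fun [set: T] (max_orbit_sum tau g N).
Proof.
move=> mtau mg; elim: N => [|N IH] /=; first exact: measurable_cst.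
apply: measurable_maxr => //; apply: measurable_funD => //.
exact: (measurableT_comp IH mtau).
Qed.

(** * Upper limits of bounded sequences *)

Section limn_sup.
Context (R : realType).
Implicit Types u v : R^nat.

Lemma bounded_fun_normP (T : Type) (f : T -> R) :
  bounded_fun f <-> exists2 K, 0 < K & forall w, `|f w| <= K.
Proof.
split=> [[M [_ fM]]|[K _ fK]]; last first.
  by exists K; split; [exact: num_real|move=> x /ltW Kx w _; exact: le_trans Kx].
exists (`|M| + 1); first by rewrite ltr_wpDl.
by move=> w; apply: (fM (`|M| + 1)) => //; rewrite ltr_pwDr// ler_norm.
Qed.

Lemma limn_sup_gt u m e : bounded_fun u -> 0 < e ->
  exists2 n, (m <= n)%N & limn_sup u - e < u n.
Proof.
move=> bu e0; have : limn_sup u - e < sups u m.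
  rewrite ltrBlDr (@le_lt_trans _ _ (sups u m)) ?ltrDl//.
  rewrite limn_supE//; apply: ge_inf; last by exists m.
  exact: bounded_fun_has_lbound_sups.
by case/sup_gt => [|_ [n /= mn <-]]; [exists (u m), m => /=|exists n].
Qed.

Lemma limn_sup_lt u e : bounded_fun u -> 0 < e ->
  \forall n \near \oo, u n < limn_sup u + e.
Proof.
move=> bu e0; have : inf (range (sups u)) < limn_sup u + e.
  by rewrite -limn_supE// ltrDl.
case/inf_lt => [|_ [m _ <-] um]; first by exists (sups u 0%N), 0%N.
exists m => // n /= mn; apply: le_lt_trans um; apply: ub_le_sup; last by exists n.
exact/has_ubound_sdrop/bounded_fun_has_ubound.
Qed.

Lemma limn_sup_norm_le u K : (forall n, `|u n| <= K) -> `|limn_sup u| <= K.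
Proof.
move=> uK; have bu : bounded_fun u.
  by exists K; split; [exact: num_real|move=> x /ltW Kx n _; exact: le_trans Kx].
rewrite ler_norml; apply/andP; split; apply/ler_addgt0Pr => e e0.
  have [n [_ un]] : exists n, True /\ u n < limn_sup u + e.
    by have /filter_ex[n un] := limn_sup_lt bu e0; exists n.
  by rewrite (le_trans _ (ltW un))//; have := uK n; rewrite ler_norml => /andP[].
have [n _ un] := limn_sup_gt 0 bu e0.
rewrite -lerBlDr (le_trans (ltW un))//.
by have := uK n; rewrite ler_norml => /andP[].
Qed.

(** Since [limn_sup (- u)] is minus the lower limit, the sum is the oscillation of [u] at
    infinity. *)
Lemma cvgn_limn_supD_oppE u : bounded_fun u ->
  cvgn u <-> limn_sup u + limn_sup (- u) <= 0.
Proof.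
move=> bu; split=> [cu|le0].
  have cNu : - u @ \oo --> - limn u by exact: cvgN.
  by rewrite cvg_limn_supE// (cvg_limn_inf_sup cNu).2 subrr.
apply/cvg_ex; exists (limn_sup u); apply/cvgrPdist_lt => e e0.
near=> n; rewrite ltr_distl.
have un : u n < limn_sup u + e by near: n; exact: limn_sup_lt.
have : - u n < limn_sup (- u) + e.
  by near: n; apply: limn_sup_lt => //; exact: bounded_funN.
move=> Nun; apply/andP; split; move: un Nun le0; lra.
Unshelve. all: by end_near. Qed.

(** Subadditivity of the upper limit applied to [u = v + (u - v)], and symmetry in [u] and [v]. *)
Lemma limn_sup_cvgB0 u v : bounded_fun u -> bounded_fun v ->
  u n - v n @[n --> \oo] --> 0 -> limn_sup u = limn_sup v.
Proof.
suff le u' v' : bounded_fun u' -> bounded_fun v' ->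
    u' n - v' n @[n --> \oo] --> 0 -> limn_sup u' <= limn_sup v'.
  move=> bu bv uv0; apply/eqP; rewrite eq_le !le//.
  by rewrite -oppr0; under eq_fun do rewrite -opprB; exact: cvgN.
move=> bu bv uv0.
have := le_limn_supD bv (bounded_funD bu (bounded_funN bv)).
rewrite (cvg_limn_inf_sup uv0).2 addr0; congr (_ <= _); congr limn_sup.
by apply/funext => n /=; rewrite addrC subrK.
Qed.

End limn_sup.

(** * The upper time average and its invariance *)

Section upper_mean.
Context (T : Type) (R : realType) (tau : T -> T).
Implicit Types f : T -> R.

Definition upper_mean f w := limn_sup (time_average tau f w).

Lemma time_averageE f w n : time_average tau f w n = n%:R^-1 * orbit_sum tau f n w.
Proof. by rewrite /time_average big_add1 /= big_mkord. Qed.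

Lemma time_averageN f w : time_average tau (\- f) w = - time_average tau f w.
Proof.
apply/funext => n; rewrite fctE !time_averageE /orbit_sum.
by rewrite -mulrN; congr (_ * _); rewrite -sumrN.
Qed.

Context (f : T -> R) (K : R) (fK : forall w, `|f w| <= K).

Lemma time_average_norm_le w n : `|time_average tau f w n| <= K.
Proof.
have K0 : 0 <= K by exact: le_trans (normr_ge0 _) (fK w).
rewrite time_averageE normrM ger0_norm; last by rewrite invr_ge0.
(* The average of length 0 is 0, by the convention [0^-1 = 0]. *)
case: n => [|n]; first by rewrite invr0 mul0r.
rewrite ler_pdivrMl ?ltr0n//; apply: le_trans (ler_norm_sum _ _ _) _.
rewrite (le_trans (ler_sum _ (fun i _ => fK _)))//.
by rewrite sumr_const card_ord mulr_natl.
Qed.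

Lemma bounded_time_average w : bounded_fun (time_average tau f w).
Proof.
exists K; split; first exact: num_real.
by move=> x /ltW Kx n _; exact: le_trans (time_average_norm_le w n) Kx.
Qed.

Lemma upper_mean_norm_le w : `|upper_mean f w| <= K.
Proof. by apply: limn_sup_norm_le; exact: time_average_norm_le. Qed.

(** The orbit sums of length [n] from [tau w] and [w] differ only in their end terms, so the
    averages differ by at most [2 * K / n]. *)
Lemma upper_mean_invariant w : upper_mean f (tau w) = upper_mean f w.
Proof.
apply: limn_sup_cvgB0; [exact: bounded_time_average..|].
apply/norm_cvg0P.
apply: (@squeeze_cvgr _ _ _ _ (cst 0) (fun n => (2 * K) * n%:R^-1)).
- near=> n; rewrite normr_ge0/= !time_averageE -mulrBr.
  rewrite normrM ger0_norm; last by rewrite invr_ge0.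
  rewrite mulrC ler_wpM2r ?invr_ge0//.
  have -> : orbit_sum tau f n (tau w) - orbit_sum tau f n w =
      f (iter n tau w) - f w.
    have := orbit_sumS tau f n w.
    by rewrite {1}/orbit_sum big_ord_recr /= -/(orbit_sum tau f n w); lra.
  by rewrite (le_trans (ler_normB _ _))// mulr_natl mulr2n lerD.
- exact: cvg_cst.
- rewrite -(mulr0 (2 * K)); apply: cvgMr.
  by rewrite -cvg_shiftS; exact: cvg_harmonic.
Unshelve. all: by end_near. Qed.

Lemma upper_mean_iter k w : upper_mean f (iter k tau w) = upper_mean f w.
Proof. by elim: k => //= k IH; rewrite upper_mean_invariant. Qed.

Lemma orbit_sum_upper_mean e n w :
  orbit_sum tau (fun w => f w - upper_mean f w + e) n w =
  orbit_sum tau f n w - n%:R * (upper_mean f w - e).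
Proof.
rewrite /orbit_sum mulr_natl -[X in _ = _ - _ *+ X]card_ord -sumr_const -sumrB.
by apply: eq_bigr => k _; rewrite upper_mean_iter opprB addrA addrAC.
Qed.

(** Some average of length [n >= 1] exceeds its upper limit minus [e]; multiplying by [n] gives the
    claim. *)
Lemma orbit_sum_gt0 e w : 0 < e ->
  exists n, 0 < orbit_sum tau (fun w => f w - upper_mean f w + e) n w.
Proof.
move=> e0; have [n n0] := limn_sup_gt 1 (bounded_time_average w) e0.
rewrite -/(upper_mean f w) time_averageE ltr_pdivlMl ?ltr0n// => ltn.
exists n; rewrite orbit_sum_upper_mean.
by move: ltn; lra.
Qed.

End upper_mean.

(** * Measurability, and integration of visit counts *)

Section measurable_upper_mean.
Context d (T : measurableType d) (R : realType) (tau : T -> T) (f : T -> R).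
Hypothesis mtau : measurable_fun [set: T] tau.
Hypothesis mf : measurable_fun [set: T] f.

Lemma measurable_time_average n :
  measurable_fun [set: T] (fun w => time_average tau f w n).
Proof.
under eq_fun do rewrite time_averageE.
apply: measurable_funM; first exact: measurable_cst.
apply: measurable_sum => k; apply: measurableT_comp => //.
exact: measurable_iter.
Qed.

Lemma measurable_upper_mean : bounded_fun f ->
  measurable_fun [set: T] (upper_mean tau f).
Proof.
move=> /bounded_fun_normP[K _ fK].
apply: measurable_fun_limn_sup => [w _|w _|n]; last exact: measurable_time_average.
  exact/bounded_fun_has_ubound/(bounded_time_average tau fK).
exact/bounded_fun_has_lbound/(bounded_time_average tau fK).
Qed.

End measurable_upper_mean.

(** Integrate the pointwise bound on [a * \1_D]; outside [D] it holds because the right-hand side is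
    nonnegative. *)
Lemma probability_indic_sum_le d (T : measurableType d) (R : realType)
    (P : probability T R) (D : set T) (H : (set T)^nat) (n : nat) (a b c : R) :
  measurable D -> (forall k, measurable (H k)) -> 0 <= a -> 0 <= b -> 0 <= c ->
  (forall w, D w -> a <= c + b * \sum_(k < n) \1_(H k) w) ->
  a * fine (P D) <= c + b * \sum_(k < n) fine (P (H k)).
Proof.
move=> mD mH a0 b0 c0 le.
have mS : measurable_fun [set: T] (fun w => (\sum_(k < n) \1_(H k) w : R)).
  by apply: measurable_sum => k; exact: measurable_indic.
have : (\int[P]_w (a * \1_D w)%:E <=
    \int[P]_w (c + b * \sum_(k < n) \1_(H k) w)%:E)%E.
  apply: ge0_le_integral => //.
  - by move=> w _; rewrite lee_fin mulr_ge0.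
  - apply/measurable_EFinP/measurable_funM; first exact: measurable_cst.
    exact: measurable_indic.
  - apply/measurable_EFinP/measurable_funD; first exact: measurable_cst.
    by apply: measurable_funM; first exact: measurable_cst.
  move=> w _; rewrite lee_fin indicE; have [/set_mem Dw|_] := boolP (w \in D).
    by rewrite mulr1 le.
  by rewrite mulr0 addr_ge0// mulr_ge0// sumr_ge0.
have -> : (\int[P]_w (a * \1_D w)%:E = (a * fine (P D))%:E)%E.
  under eq_integral do rewrite EFinM.
  rewrite ge0_integralZl_EFin//; last by apply/measurable_EFinP/measurable_indic.
  by rewrite integral_indic// setIT EFinM fineK// fin_num_measure.
under [X in (_ <= X)%E]eq_integral do rewrite EFinD EFinM -sumEFin.
rewrite ge0_integralD//=; last 2 first.
  - by move=> w _; rewrite mule_ge0 ?lee_fin// sume_ge0.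
  - apply: emeasurable_funM; first exact: measurable_cst.
    by apply: emeasurable_sum => k; exact/measurable_EFinP/measurable_indic.
rewrite integral_cst//= probability_setT mule1 ge0_integralZl_EFin//; last 2 first.
  - by move=> w _; rewrite sume_ge0// => k _; rewrite lee_fin.
  - by apply: emeasurable_sum => k; exact/measurable_EFinP/measurable_indic.
rewrite ge0_integral_sum//; last by move=> k; exact/measurable_EFinP/measurable_indic.
rewrite (eq_bigr (fun k : 'I_n => (fine (P (H k)))%:E)) => [|k _]; last first.
  by rewrite integral_indic// setIT fineK// fin_num_measure.
by rewrite sumEFin -EFinM -EFinD lee_fin.
Qed.

(** * Upper and lower time averages agree almost surely *)

Section mean_gap.
Context d (T : measurableType d) (R : realType) (tau : T -> T) (nu : set T -> R).
Hypothesis mtau : measurable_fun [set: T] tau.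
Hypothesis nu_lower : lower_probability nu.
Hypothesis nu_inv : invariant_set_function tau nu.

Lemma lower_probability_iter k A : measurable A -> nu (iter k tau @^-1` A) = nu A.
Proof.
move=> mA; elim: k => [//|k IH].
rewrite (_ : _ @^-1` A = tau @^-1` (iter k tau @^-1` A)); last first.
  by apply/seteqP; split=> w; rewrite /preimage/= -iterSr.
rewrite -nu_inv//.
by rewrite -[X in measurable X]setTI; exact: measurable_iter.
Qed.

Lemma positive_max_orbit_sum_cover (g : T -> R) :
  (forall w, exists n, 0 < orbit_sum tau g n w) ->
  \bigcup_N [set w | 0 < max_orbit_sum tau g N w] = setT.
Proof.
move=> g_gt0; apply/seteqP; split=> // w _; have [n gn] := g_gt0 w.
by exists n => //=; exact: lt_le_trans (max_orbit_sum_ge _ _ _ _).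
Qed.

(** The bounds [orbit_sum_ge] for [g1] and [g2] are integrated over the set [D] in question. Fixing
    [N] first, with [nu (B1 N]&[B2 N)] near 1, and then taking [n] large makes [P D] arbitrarily
    small. *)
Lemma upper_mean_gap_null (f : T -> R) (e : R) (P : probability T R) :
  bounded_measurable f -> 0 < e -> core nu P ->
  P [set w | e <= upper_mean tau f w + upper_mean tau (\- f) w] = 0%E.
Proof.
move=> [/bounded_fun_normP[K K0 fK] mf] e0 cP; set D := [set w | _].
have NfK w : `|(\- f) w| <= K by rewrite normrN.
(* Two slacks of [e / 3] out of a gap of at least [e] leave [e / 3] per orbit step. Both functions
   are bounded by [2 * K + e / 3], hence by [C]. *)
pose g1 w := f w - upper_mean tau f w + e / 3.
pose g2 w := (\- f) w - upper_mean tau (\- f) w + e / 3.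
pose C : R := 2 * K + e.
have bf : bounded_fun f by apply/bounded_fun_normP; exists K.
have bNf : bounded_fun (\- f) by apply/bounded_fun_normP; exists K.
have mNf : measurable_fun [set: T] (\- f) by exact: measurable_funN.
have mu1 := measurable_upper_mean mtau mf bf.
have mu2 := measurable_upper_mean mtau mNf bNf.
have gC (h : T -> R) w : (forall w, `|h w| <= K) ->
    `|h w - upper_mean tau h w + e / 3| <= C.
  move=> hK; have := hK w; have := upper_mean_norm_le tau hK w.
  by rewrite !ler_norml /C; move: e0; lra.
have g1C w : `|g1 w| <= C by exact: gC.
have g2C w : `|g2 w| <= C by exact: gC.
have mg1 : measurable_fun [set: T] g1.
  by apply: measurable_funD => //; exact: measurable_funB.
have mg2 : measurable_fun [set: T] g2.
  by apply: measurable_funD => //; exact: measurable_funB.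
have e30 : 0 < e / 3 by rewrite divr_gt0.
pose B1 N := [set w | 0 < max_orbit_sum tau g1 N w].
pose B2 N := [set w | 0 < max_orbit_sum tau g2 N w].
have mB (g : T -> R) N : measurable_fun [set: T] g ->
    measurable [set w | 0 < max_orbit_sum tau g N w].
  move=> mg; rewrite -[X in measurable X]setTI.
  apply: measurable_fun_ltr => //; exact: measurable_max_orbit_sum.
have mB12 N : measurable (B1 N `&` B2 N) by apply: measurableI; exact: mB.
have ndB (g : T -> R) :
    nondecreasing_seq (fun N => [set w | 0 < max_orbit_sum tau g N w]).
  move=> m n mn; apply/subsetPset => w /= /lt_le_trans; apply.
  exact: nondecreasing_max_orbit_sum.
have B1T : \bigcup_N B1 N = setT.
  by apply: positive_max_orbit_sum_cover => w; exact: (orbit_sum_gt0 tau fK).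
have B2T : \bigcup_N B2 N = setT.
  by apply: positive_max_orbit_sum_cover => w; exact: (orbit_sum_gt0 tau NfK).
have ndB12 : nondecreasing_seq (fun N => B1 N `&` B2 N).
  move=> m n mn; apply/subsetPset; apply: setISS; apply/subsetPset.
    exact: ndB.
  exact: ndB.
have B12T : \bigcup_N (B1 N `&` B2 N) = setT.
  apply/seteqP; split=> // w _.
  have [i _ B1i] : (\bigcup_N B1 N) w by rewrite B1T.
  have [j _ B2j] : (\bigcup_N B2 N) w by rewrite B2T.
  exists (maxn i j) => //; split.
    by have /subsetPset := ndB g1 _ _ (leq_maxl i j); exact.
  by have /subsetPset := ndB g2 _ _ (leq_maxr i j); exact.
have C0 : 0 < C by rewrite /C; move: K0 e0; lra.
have mD : measurable D.
  rewrite -[X in measurable X]setTI; apply: measurable_fun_ler => //.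
  exact: measurable_funD.
have key : forall N n, n%:R * (e / 3) * fine (P D) <=
    2 * (N%:R * C) + 2 * C * (n%:R * (1 - nu (B1 N `&` B2 N))).
  move=> N n; pose H k := iter k tau @^-1` (~` (B1 N `&` B2 N)).
  have mH k : measurable (H k).
    rewrite -[X in measurable X]setTI; apply: measurable_iter => //.
    exact: measurableC.
  (* Uniform in [k]: [P] dominates [nu] on the preimage, where [nu] keeps its value by
     invariance. *)
  have PH k : fine (P (H k)) <= 1 - nu (B1 N `&` B2 N).
    rewrite -lee_fin fineK ?fin_num_measure// /H -preimage_setC.
    have mHB : measurable (iter k tau @^-1` (B1 N `&` B2 N)).
      by rewrite -[X in measurable X]setTI; exact: measurable_iter.
    rewrite probability_setC// EFinB leeB//.
    by rewrite -(lower_probability_iter k)//; exact: cP.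
  have -> : n%:R * (1 - nu (B1 N `&` B2 N)) =
      \sum_(k < n) (1 - nu (B1 N `&` B2 N)).
    by rewrite sumr_const card_ord mulr_natl.
  apply: le_trans (_ : _ <= 2 * (N%:R * C) + 2 * C * \sum_(k < n) fine (P (H k))) _.
    apply: probability_indic_sum_le => //.
    - by rewrite mulr_ge0// ltW.
    - by rewrite mulr_ge0// ltW.
    - by rewrite !mulr_ge0// ltW.
    move=> w Dw.
    have H1 (g : T -> R) : (forall v, (B1 N `&` B2 N) v -> 0 < max_orbit_sum tau g N v) ->
        \sum_(k < n) \1_[set v | max_orbit_sum tau g N v <= 0] (iter k tau w) <=
        \sum_(k < n) \1_(H k) w :> R.
      move=> gB; apply: ler_sum => k _; rewrite !indicE ler_nat.
      have [/set_mem/= g0|//] := boolP (_ \in _).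
      by rewrite mem_set//= => /gB; rewrite ltNge g0.
    (* In the sum of these two bounds the orbit sums of [f] and [\- f] cancel, and the left-over
       [- n * gap + 2 * n * e / 3] is at most [- n * e / 3] on [D]. *)
    have := orbit_sum_ge tau g1C N n w; have := orbit_sum_ge tau g2C N n w.
    rewrite /g1 /g2 !(orbit_sum_upper_mean tau fK, orbit_sum_upper_mean tau NfK).
    have -> : orbit_sum tau (\- f) n w = - orbit_sum tau f n w.
      by rewrite /orbit_sum sumrN.
    have /(ler_wpM2l (ltW C0)) := H1 g1 (fun v h => h.1).
    have /(ler_wpM2l (ltW C0)) := H1 g2 (fun v h => h.2).
    rewrite -/g1 -/g2.
    have := ler_wpM2l (ler0n R n) Dw.
    move: (\sum_(k < n) _) (\sum_(k < n) _) (\sum_(k < n) _) => x y z.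
    lra.
  rewrite lerD2l ler_wpM2l//; first by rewrite mulr_ge0// ltW.
  by apply: ler_sum => k _; exact: PH.
apply/eqP; rewrite -[P D]fineK ?fin_num_measure// eqe eq_le fine_ge0 ?andbT//.
apply/ler_addgt0Pr => r r0; rewrite add0r.
(* The target [n * (e / 3) * r] is split in halves: this tolerance makes the visit term at most one
   half, and [n] below makes the boundary term [2 * (N%:R * C)] less than the other. *)
have s0 : 0 < r * (e / 3) / (4 * C) by rewrite !(divr_gt0, mulr_gt0).
have [N NB] := lower_probability_continuousT nu_lower mB12 ndB12 B12T s0.
pose n := (Num.truncn (2 * (N%:R * C) / (r * (e / 3) / 2))).+1.
have nlt : 2 * (N%:R * C) < n%:R * (r * (e / 3) / 2).
  by rewrite -ltr_pdivrMr ?truncnS_gt// !(divr_gt0, mulr_gt0).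
have n0 : 0 < n%:R :> R by rewrite ltr0n.
have ne : 0 < n%:R * (e / 3) by rewrite mulr_gt0.
rewrite -(ler_pM2l ne); apply: le_trans (key N n) _.
have : 2 * C * (n%:R * (1 - nu (B1 N `&` B2 N))) <= n%:R * (r * (e / 3) / 2).
  rewrite mulrCA ler_wpM2l ?(ltW n0)//.
  have : 1 - nu (B1 N `&` B2 N) <= r * (e / 3) / (4 * C) by move: NB; lra.
  rewrite ler_pdivlMr ?mulr_gt0//; lra.
move: nlt; lra.
Qed.

End mean_gap.

(** * Choquet integrals of functions with 0-1 level values *)

(** The level function is the indicator of a half-line ending at [s], closed exactly when [b] holds;
    the two integrals are [Num.max 0 s] and [Num.min 0 s]. *)
Lemma choquet_threshold (T : Type) (R : realType) (nu : set T -> R) (f : T -> R)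
    (s : R) (b : bool) : nu setT = 1 ->
  (forall t, nu [set w | t <= f w] = (t < s ?<= if b)%:R) -> choquet nu f = s.
Proof.
move=> nuT nuE; rewrite /choquet /Rintegral.
pose A : set R := [set` Interval -oo%O (BSide (~~ b) s)].
have mA : measurable A by exact: measurable_itv.
have AE t : (t \in A) = (t < s ?<= if b).
  by rewrite mem_setE in_itv/=; case: b {nuE A mA}.
have -> : (\int[lebesgue_measure]_(t in `[0%R, +oo[) (nu [set w | (t <= f w)%R])%:E =
    (Num.max 0 s)%:E)%E.
  under eq_integral do rewrite nuE -AE -indicE.
  rewrite integral_indic//.
  have -> : A `&` `[0, +oo[ = [set` Interval (BLeft 0) (BSide (~~ b) s)].
    apply/seteqP; split=> t; rewrite /A/= !in_itv/= ?andbT.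
      by move=> [-> ->].
    by move=> /andP[-> ->].
  apply: etrans (lebesgue_measure_itv _) _; rewrite /= lte_fin.
  by case: ltP => s0; rewrite ?sube0.
have -> : (\int[lebesgue_measure]_(t in `]-oo, 0%R])
    (nu [set w | (t <= f w)%R] - nu setT)%:E = (Num.min 0 s)%:E)%E.
  have -> : (\int[lebesgue_measure]_(t in `]-oo, 0%R])
      (nu [set w | (t <= f w)%R] - nu setT)%:E =
      \int[lebesgue_measure]_(t in `]-oo, 0%R]) (- (\1_(~` A) t)%:E))%E.
    apply: eq_integral => t _; rewrite nuE nuT -AE -EFinN !indicE in_setC.
    by case: (t \in A); rewrite ?subrr ?oppr0 ?sub0r.
  rewrite integral_ge0N; last by move=> t _; rewrite lee_fin.
  rewrite integral_indic//; last exact: measurableC.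
  have -> : ~` A `&` `]-oo, 0] = [set` Interval (BSide (~~ b) s) (BRight 0)].
    apply/seteqP; split=> t; rewrite /A/= !in_itv/=.
      by move=> [/negP + ->]; case: b {nuE A mA AE} => /=; rewrite -?ltNge -?leNgt => ->.
    move=> /andP[+ ->]; case: b {nuE A mA AE} => /= h; split=> //; apply/negP.
      by rewrite -ltNge.
    by rewrite -leNgt.
  rewrite [X in (- X)%E](_ : _ = if s < 0 then (- s)%:E else 0%E); last first.
    apply: etrans (lebesgue_measure_itv _) _.
    by rewrite /= lte_fin; case: ifP => // _; rewrite add0e.
  have [s0|s0] := ltP s 0; last first.
    by rewrite oppe0; congr EFin; apply/esym/min_idPl.
  by rewrite EFinN oppeK; congr EFin; apply/esym/min_idPr/ltW.
by rewrite /= addr_max_min add0r.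
Qed.

(** The jump is at the supremum of [h = 1], a set that the bounds at [- K] and [K] make nonempty and
    bounded above; [b] records the value at the jump. *)
Lemma threshold_of_01 (R : realType) (h : R -> R) (K : R) :
  (forall t, h t = 0 \/ h t = 1) -> {homo h : s t / s <= t >-> t <= s} ->
  (forall t, t < - K -> h t = 1) -> (forall t, K < t -> h t = 0) ->
  exists s b, forall t, h t = (t < s ?<= if b)%:R.
Proof.
move=> h01 hni h1 h0.
pose S := [set t | h t = 1].
have S0 : S !=set0 by exists (- K - 1); apply: h1; rewrite ltrBlDr ltrDl.
have Sub : has_ubound S.
  exists K => t St; rewrite leNgt; apply/negP => /h0.
  by rewrite St => /eqP; rewrite oner_eq0.
exists (sup S), (h (sup S) == 1) => t.
have [ts|ts|->] := ltgtP t (sup S).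
- rewrite lteifS//; have [u Su tu] := sup_gt S0 ts.
  have [ht|//] := h01 t; have := hni _ _ (ltW tu).
  by rewrite ht Su ler10.
- have [->|ht] := h01 t.
    by case: (_ == _) => /=; [rewrite leNgt ts|rewrite ltNge (ltW ts)].
  by have := ub_le_sup Sub ht; rewrite leNgt ts.
- by rewrite lteifxx; have [->|->] := h01 (sup S); rewrite ?eqxx// eq_sym oner_eq0.
Qed.
(** [g <= s] is the countable intersection of the events [g < s + n.+1%:R^-1]. *)
Lemma lower_probability_le_threshold d (T : measurableType d) (R : realType)
    (nu : set T -> R) (g : T -> R) (s : R) : lower_probability nu ->
  measurable_fun [set: T] g -> (forall t, s < t -> nu [set w | g w < t] = 1) ->
  nu [set w | g w <= s] = 1.
Proof.
move=> nu_lower mg nu1.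
have -> : [set w | g w <= s] = \bigcap_n [set w | g w < s + n.+1%:R^-1].
  apply/seteqP; split=> w /= => [gs n _ /=|gs].
    by rewrite (le_lt_trans gs)// ltrDl invr_gt0.
  rewrite leNgt; apply/negP => /ltr_add_invr[n sn].
  by have := gs n I; rewrite /= ltNge (ltW sn).
apply: lower_probability_bigcap1 => // n; last by apply: nu1; rewrite ltrDl invr_gt0.
by rewrite -[X in measurable X]setTI; exact: measurable_fun_ltr.
Qed.

(** * Almost sure convergence and the ergodic bounds *)

Theorem theorem2 (R : realType) (d : measure_display) (T : measurableType d)
    (tau : T -> T) (mtau : measurable_fun [set: T] tau)
    (nu : set T -> R) (nu_lower : lower_probability nu)
    (nu_inv : invariant_set_function tau nu)
    (f : T -> R) (fB : bounded_measurable f) :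
  exists fstar : T -> R,
    [/\ bounded_measurable
          (fstar : g_sigma_algebraType (invariant_events tau) -> R),
        almost_surely nu
          (fun w => time_average tau f w n @[n --> \oo] --> fstar w) &
        ergodic tau nu ->
        nu [set w | cvgn (time_average tau f w) /\
                    choquet nu fstar <= limn (time_average tau f w)
                                     <= choquet (conjugate nu) fstar] = 1].
Proof.
have [bf mf] := fB; have [K K0 fK] := (bounded_fun_normP f).1 bf.
have bNf : bounded_fun (\- f) by apply/bounded_fun_normP; exists K => // w; rewrite normrN.
have mNf : measurable_fun [set: T] (\- f) by exact: measurable_funN.
pose F := upper_mean tau f.
have mF : measurable_fun [set: T] F by exact: measurable_upper_mean.
have mNF : measurable_fun [set: T] (upper_mean tau (\- f)).
  exact: measurable_upper_mean.
have FK w : `|F w| <= K by exact: upper_mean_norm_le.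
(* [F] is invariant at every point, so its preimages are strictly invariant events. *)
have iF Y : measurable Y -> invariant_events tau (F @^-1` Y).
  move=> mY; split; first by rewrite -[X in measurable X]setTI; exact: mF.
  apply/seteqP; split=> w; rewrite /preimage /=.
    by rewrite /F (upper_mean_invariant tau fK).
  by rewrite /F (upper_mean_invariant tau fK).
(* Upper minus lower limit of the time averages. *)
pose gap w := F w + upper_mean tau (\- f) w.
have mgap : measurable_fun [set: T] gap by exact: measurable_funD.
have nu_cvg : nu [set w | gap w <= 0] = 1.
  apply: lower_probability_le_threshold => // t t0.
  have mt : measurable [set w | gap w < t].
    by rewrite -[X in measurable X]setTI; exact: measurable_fun_ltr.
  apply/lower_probability_eq1 => // P cP.
  rewrite -[X in P X]setCK probability_setC; last exact: measurableC.
  have -> : ~` [set w | gap w < t] = [set w | t <= gap w].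
    by apply/seteqP; split=> w /=; rewrite leNgt => /negP.
  by rewrite (upper_mean_gap_null mtau nu_lower nu_inv fB t0 cP) sube0.
have cvgE w : cvgn (time_average tau f w) <-> gap w <= 0.
  rewrite /gap /F /upper_mean (_ : time_average tau (\- f) w = - time_average tau f w).
    exact: cvgn_limn_supD_oppE (bounded_time_average tau fK w).
  exact: time_averageN.
have limE w : cvgn (time_average tau f w) -> limn (time_average tau f w) = F w.
  by move=> cw; rewrite -cvg_limn_supE.
have mcvg : measurable [set w | gap w <= 0].
  by rewrite -[X in measurable X]setTI; exact: measurable_fun_ler.
exists F; split.
- split; first by apply/bounded_fun_normP; exists K.
  move=> _ Y mY; rewrite setTI measurable_invariantE//; exact: iF.
- exists [set w | gap w <= 0]; split => // w /cvgE cw.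
  by rewrite -(limE _ cw).
move=> erg.
have nu01 A : invariant_events tau A -> nu A = 0 \/ nu A = 1.
  move=> iA; have : (nu @` invariant_events tau) (nu A) by exists A.
  by rewrite erg.
have iGe t : invariant_events tau [set w | t <= F w].
  have -> : [set w | t <= F w] = F @^-1` `[t, +oo[.
    by apply/seteqP; split=> w; rewrite /= in_itv/= andbT.
  exact: iF.
have iLt t : invariant_events tau [set w | F w < t].
  have -> : [set w | F w < t] = F @^-1` `]-oo, t[.
    by apply/seteqP; split=> w; rewrite /= in_itv.
  exact: iF.
have geC t : ~` [set w | t <= F w] = [set w | F w < t].
  by apply/seteqP; split=> w /=; rewrite ltNge => /negP.
have FleK w : - K <= F w <= K by rewrite -ler_norml.
have geT t : t < - K -> [set w | t <= F w] = setT.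
  move=> tK; apply/seteqP; split=> // w _ /=.
  by have /andP[+ _] := FleK w; apply: le_trans; exact: ltW.
have ge0 t : K < t -> [set w | t <= F w] = set0.
  move=> Kt; apply/seteqP; split=> // w /= tF.
  by have /andP[_ /(le_trans tF)] := FleK w; rewrite leNgt Kt.
have [s [b sE]] : exists s b, forall t, nu [set w | t <= F w] = (t < s ?<= if b)%:R.
  apply: (threshold_of_01 (K := K)) => [t|t u tu|t /geT ->|t /ge0 ->].
  - exact: nu01.
  - apply: lower_probability_le => //; [exact: (iGe _).1..|].
    by move=> w /=; exact: le_trans.
  - exact: lower_probabilityT.
  - exact: lower_probability0.
(* The complements [F w < t] are invariant too, so the conjugate is also 0-1 on superlevel sets. *)
have [s' [b' s'E]] : exists s b, forall t,
    conjugate nu [set w | t <= F w] = (t < s ?<= if b)%:R.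
  apply: (threshold_of_01 (K := K)) => [t|t u tu|t /geT ->|t /ge0 ->];
    rewrite /conjugate.
  - by rewrite geC; have [->|->] := nu01 _ (iLt t); rewrite ?subr0 ?subrr; [right|left].
  - rewrite lerB// !geC; apply: lower_probability_le => //; [exact: (iLt _).1..|].
    by move=> w /= /lt_le_trans; apply.
  - by rewrite setCT lower_probability0 ?subr0.
  - by rewrite setC0 lower_probabilityT ?subrr.
rewrite (choquet_threshold (lower_probabilityT nu_lower) sE).
rewrite (choquet_threshold _ s'E); last first.
  by rewrite /conjugate setCT lower_probability0 ?subr0.
have nu_ge : nu [set w | s <= F w] = 1.
  have -> : [set w | s <= F w] = [set w | - F w <= - s].
    by apply/seteqP; split=> w /=; rewrite lerN2.
  apply: lower_probability_le_threshold => // [|t st]; first exact: measurable_funN.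
  (* The midpoint of [- t] and [s]: below [s], so its superlevel set has value 1, and above [- t],
     so that set lies in [- F w < t]. *)
  apply: (lower_probability_sub1 nu_lower (iGe ((s - t) / 2)).1).
  - by rewrite -[X in measurable X]setTI; apply: measurable_fun_ltr => //;
      exact: measurable_funN.
  - by move=> w /=; move: st; lra.
  - by rewrite sE lteifS//; move: st; lra.
(* Beyond [s'] the conjugate of [t <= F w] vanishes, which says that [F w < t] has value 1. *)
have nu_le : nu [set w | F w <= s'] = 1.
  apply: lower_probability_le_threshold => // t s't.
  have := s'E t; rewrite /conjugate geC.
  have -> : (t < s' ?<= if b') = false.
    by case: (b') => /=; [rewrite leNgt s't|rewrite ltNge (ltW s't)].
  by move=> /eqP; rewrite subr_eq0 => /eqP.
have mge := (iGe s).1.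
have mle : measurable [set w | F w <= s'].
  by rewrite -[X in measurable X]setTI; exact: measurable_fun_ler.
rewrite (_ : [set w | _] =
    [set w | gap w <= 0] `&` ([set w | s <= F w] `&` [set w | F w <= s'])).
  apply: lower_probability_setI1 => //; first exact: measurableI.
  exact: lower_probability_setI1.
apply/seteqP; split=> w /=.
  by move=> [cw /andP[]]; rewrite (limE _ cw) => sF Fs; split=> //; exact/cvgE.
by move=> [/cvgE cw [sF Fs]]; split=> //; rewrite (limE _ cw) sF Fs.
Qed.
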